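(* Let $n>4$ and let $f:C_n\to C_n$ be a continuous selfmap of the digital cycle $C_n$. Then for all $q>1$ the induced homomorphism $f_{*,q}:H_q(C_n)\to H_q(C_n)$ is trivial; for $q=0$ we have $f_{*,0}=\mathrm{id}$; and for $q=1$ we have \[ f_{*,1}=\begin{cases}\mathrm{id}&\text{if } f\simeq \mathrm{id}_{C_n},\\ -\mathrm{id}&\text{if } f\simeq l,\\ 0&\text{if } f\simeq c,\end{cases}\] where $c:C_n\to C_n$ is the constant map $c(c_i)=c_0$ and $l:C_n\to C_n$ is the flip map $l(c_i)=c_{-i}$.
   Context: A digital image is a set $X$ together with a symmetric, antireflexive adjacency relation (equivalently, a simple graph). Write $x\leftrightarrow x'$ for ''adjacent'' and $x\mathrel{\underline{\leftrightarrow}} x'$ for ''adjacent or equal''. A function $f:X\to Y$ between digital images is continuous if $x\leftrightarrow x'$ implies $f(x)\mathrel{\underline{\leftrightarrow}} f(x')$. For integers $a\le b$, $[a,b]_{\mathbb Z}=\{a,\dots,b\}$, where $s,t$ are adjacent iff $|s-t|=1$. The digital cycle is $C_n=\{c_0,\dots,c_{n-1}\}$ with adjacencies exactly $c_i\leftrightarrow c_{i+1}$ for each $i$, subscripts read modulo $n$. Homotopy ($\simeq$): continuous $f,g:X\to Y$ are homotopic, $f\simeq g$, if for some positive integer $k$ there is $H:X\times[0,k]_{\mathbb Z}\to Y$ with $H(x,0)=f(x)$, $H(x,k)=g(x)$ for all $x$, such that $t\mapsto H(x,t)$ is continuous for each fixed $x$ and $x\mapsto H(x,t)$ is continuous for each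 fixed $t$. Digital homology (the simplicial homology of the clique complex): a $q$-simplex of $X$ is a set of $q+1$ mutually adjacent points, written $\langle x_0,\dots,x_q\rangle$. The chain group $C_q(X)$ (not to be confused with the cycle $C_n$) is the free abelian group generated by the $q$-simplices, with the identification $\langle x_0,\dots,x_q\rangle=(-1)^\rho\langle x_{\rho(0)},\dots,x_{\rho(q)}\rangle$ for permutations $\rho$, where $(-1)^\rho$ is the sign of $\rho$. The boundary $\partial_q:C_q(X)\to C_{q-1}(X)$ is given by $\partial_q\langle x_0,\dots,x_q\rangle=\sum_{i=0}^q(-1)^i\langle x_0,\dots,\widehat{x_i},\dots,x_q\rangle$ (with $\partial_0=0$). Put $Z_q(X)=\ker\partial_q$, $B_q(X)=\operatorname{im}\partial_{q+1}$, $H_q(X)=Z_q(X)/B_q(X)$. A continuous $f:X\to Y$ induces $f_\#:C_q(X)\to C_q(Y)$, $f_\#\langle x_0,\dots,x_q\rangle=\langle f(x_0),\dots,f(x_q)\rangle$, interpreted as $0$ if the points $f(x_0),\dots,f(x_q)$ are not all distinct, and hence a homomorphism $f_{*,q}:H_q(X)\to H_q(Y)$. *)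

(* Defs.v *)
From HB Require Import structures.
From mathcomp Require Import freeg.
From mathcomp Require Import all_boot all_order all_algebra perm generic_quotient.
From mathcomp Require Import boolp zify.

Set Implicit Arguments.
Unset Strict Implicit.
Unset Printing Implicit Defensive.

Import GRing.Theory Num.Theory.

Local Open Scope ring_scope.
Local Open Scope quotient_scope.

Section GeneratedSubgroup.
Variables (V : zmodType) (S : V -> Prop).

Inductive generated : V -> Prop :=
| generated_mem x : S x -> generated x
| generated0 : generated 0
| generatedB x y : generated x -> generated y -> generated (x - y).

Definition gen_subgroup : {pred V} := fun x => `[< generated x >].

Fact gen_subgroup_closed : zmod_closed gen_subgroup.
Proof.
split; first exact/asboolP/generated0.
by move=> x y /asboolP gx /asboolP gy; exact/asboolP/generatedB.
Qed.

HB.instance Definition _ :=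
  GRing.isZmodClosed.Build V gen_subgroup gen_subgroup_closed.

End GeneratedSubgroup.

Notation "{ 'quot' I }" := (Quotient.quot I) : type_scope.

Section QuotientProjection.
Variables (V : zmodType) (I : zmodClosed V).

Definition quot_pi (x : V) : {quot I} := \pi_{quot I} x.

Fact quot_pi_additive : zmod_morphism quot_pi.
Proof. by move=> x y; rewrite /quot_pi raddfB. Qed.

HB.instance Definition _ :=
  GRing.isZmodMorphism.Build V {quot I} quot_pi quot_pi_additive.

Lemma quot_pi_eq x y : (quot_pi x == quot_pi y) = (x - y \in I).
Proof. by rewrite Quotient.idealrBE. Qed.

Lemma quot_pi_eq0 x : (quot_pi x == 0) = (x \in I).
Proof. by rewrite -(raddf0 quot_pi) quot_pi_eq subr0. Qed.

Lemma quot_piP (c : {quot I}) : exists x, c = quot_pi x.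
Proof. by exists (repr c); rewrite /quot_pi reprK. Qed.

End QuotientProjection.

Arguments quot_pi {V} I x.

Section QuotientLift.
Variables (V W : zmodType) (I : zmodClosed V) (f : {additive V -> W}).
Hypothesis fI : forall x, x \in I -> f x = 0.

Definition quot_lift of (forall x, x \in I -> f x = 0) :=
  fun c : {quot I} => f (repr c).

Lemma quot_liftE x : quot_lift fI (quot_pi I x) = f x.
Proof.
apply/eqP; rewrite -subr_eq0 -raddfB; apply/eqP/fI.
by rewrite -quot_pi_eq /quot_pi reprK.
Qed.

Fact quot_lift_additive : zmod_morphism (quot_lift fI).
Proof.
move=> a b; have [x ->] := quot_piP a; have [y ->] := quot_piP b.
by rewrite -raddfB !quot_liftE raddfB.
Qed.

HB.instance Definition _ :=
  GRing.isZmodMorphism.Build {quot I} W (quot_lift fI) quot_lift_additive.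

End QuotientLift.

Section Kernel.
Variables (V W : zmodType) (f : {additive V -> W}).

Definition in_ker : {pred V} := fun x => f x == 0.

Fact in_ker_closed : zmod_closed in_ker.
Proof.
split; first by rewrite unfold_in raddf0.
by move=> x y; rewrite !unfold_in raddfB => /eqP-> /eqP->; rewrite subrr.
Qed.

HB.instance Definition _ := GRing.isZmodClosed.Build V in_ker in_ker_closed.

Record ker := Ker { ker_val :> V; ker_valP : ker_val \in in_ker }.

HB.instance Definition _ := [isSub for ker_val].
HB.instance Definition _ := [Choice of ker by <:].
HB.instance Definition _ := [SubChoice_isSubZmodule of ker by <:].

End Kernel.

(** The group ker f / im g, for U -g-> V -f-> W with f \o g = 0. The latter is
    not required here; for chains it is [boundary_boundary]. *)
Section Subquotient.
Variables (U V W : zmodType) (g : {additive U -> V}) (f : {additive V -> W}).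

Definition in_im : {pred ker f} := fun z => `[< exists u, g u = val z >].
Arguments in_im : clear implicits.

Fact in_im_closed : zmod_closed in_im.
Proof.
split; first by apply/asboolP; exists 0; rewrite !raddf0.
move=> x y /asboolP[u gu] /asboolP[v gv].
by apply/asboolP; exists (u - v); rewrite !raddfB gu gv.
Qed.

HB.instance Definition _ := GRing.isZmodClosed.Build (ker f) in_im in_im_closed.

Definition ker_mod_im : zmodType := {quot in_im}.

End Subquotient.

Arguments in_im {U V W} g f _.

Section SubquotientMap.
Variables (U V W U' V' W' : zmodType).
Variables (g : {additive U -> V}) (f : {additive V -> W}).
Variables (g' : {additive U' -> V'}) (f' : {additive V' -> W'}).
Variables (a : {additive U -> U'}) (b : {additive V -> V'}).
Variables (c : {additive W -> W'}).
Hypothesis ag : forall u, b (g u) = g' (a u).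
Hypothesis bf : forall v, c (f v) = f' (b v).

Fact ker_map_subproof (z : ker f) : b (val z) \in in_ker f'.
Proof. by have /eqP fz := valP z; rewrite unfold_in -bf fz raddf0. Qed.

Definition ker_map (z : ker f) : ker f' := Ker (ker_map_subproof z).

Fact ker_map_additive : zmod_morphism ker_map.
Proof. by move=> x y; apply: val_inj; rewrite /= !raddfB. Qed.

HB.instance Definition _ :=
  GRing.isZmodMorphism.Build (ker f) (ker f') ker_map ker_map_additive.

Definition pi_ker_map (z : ker f) : ker_mod_im g' f' :=
  quot_pi (in_im g' f') (ker_map z).

Fact pi_ker_map_additive : zmod_morphism pi_ker_map.
Proof. by move=> x y; rewrite /pi_ker_map !raddfB. Qed.

HB.instance Definition _ := GRing.isZmodMorphism.Build
  (ker f) (ker_mod_im g' f') pi_ker_map pi_ker_map_additive.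

Fact pi_ker_map_im (z : ker f) : z \in in_im g f -> pi_ker_map z = 0.
Proof.
move=> /asboolP[u gu]; apply/eqP; rewrite quot_pi_eq0.
by apply/asboolP; exists (a u); rewrite -ag gu.
Qed.

Definition ker_mod_im_map : {additive ker_mod_im g f -> ker_mod_im g' f'} :=
  quot_lift pi_ker_map_im.

Lemma ker_mod_im_mapE (z : ker f) :
  ker_mod_im_map (quot_pi (in_im g f) z) = quot_pi (in_im g' f') (ker_map z).
Proof. exact: quot_liftE. Qed.

End SubquotientMap.

Arguments ker_mod_im_map : simpl never.

Record digital_image := DigitalImage {
  point :> choiceType;
  adj : rel point;
  adj_sym : symmetric adj;
  adj_irr : irreflexive adj
}.

Definition adjeq (X : digital_image) : rel X := fun x y => adj x y || (x == y).

Definition dcontinuous (X Y : digital_image) (f : X -> Y) : Prop :=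
  forall x x' : X, adj x x' -> adjeq (f x) (f x').

Section Interval.
Variable k : nat.

Definition interval_adj : rel 'I_k.+1 :=
  fun s t => `|(s : nat)%:Z - (t : nat)%:Z| == 1.

Fact interval_adj_sym : symmetric interval_adj.
Proof. by move=> s t; rewrite /interval_adj distrC. Qed.

Fact interval_adj_irr : irreflexive interval_adj.
Proof. by move=> s; rewrite /interval_adj subrr. Qed.

Definition digital_interval : digital_image :=
  DigitalImage interval_adj_sym interval_adj_irr.

End Interval.

(** The end conditions at 0 and k force f and g to be continuous. *)
Definition homotopic (X Y : digital_image) (f g : X -> Y) : Prop :=
  exists k : nat, (0 < k)%N /\
  exists H : X -> digital_interval k -> Y,
  [/\ forall x, H x ord0 = f x,
      forall x, H x ord_max = g x,
      forall x, dcontinuous (H x) &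
      forall t, dcontinuous (fun x => H x t)].

Section Cycle.
Variable n : nat.

Definition cycle_adj : rel 'Z_n := fun i j => (j == i + 1) || (i == j + 1).

Fact cycle_adj_sym : symmetric cycle_adj.
Proof. by move=> i j; rewrite /cycle_adj orbC. Qed.

Fact cycle_adj_irr : irreflexive cycle_adj.
Proof.
move=> i; rewrite /cycle_adj orbb -[X in X == _]addr0.
by rewrite (inj_eq (addrI i)) eq_sym oner_eq0.
Qed.

(** The digital cycle on n points, only meaningful for n >= 2: ['Z_n] is the
    ring of integers modulo n only in that case. *)
Definition digital_cycle : digital_image :=
  DigitalImage cycle_adj_sym cycle_adj_irr.

Definition cycle_const : digital_cycle -> digital_cycle := fun=> (0 : 'Z_n).
Definition cycle_flip : digital_cycle -> digital_cycle :=
  fun i => (- (i : 'Z_n) : 'Z_n).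

Lemma cycle_const_continuous : dcontinuous cycle_const.
Proof. by move=> i j _; rewrite /adjeq eqxx orbT. Qed.

Lemma cycle_flip_continuous : dcontinuous cycle_flip.
Proof.
move=> i j /= /orP[]/eqP->; rewrite /adjeq /= /cycle_adj /cycle_flip.
  by rewrite opprD subrK eqxx orbT.
by rewrite opprD subrK eqxx.
Qed.

End Cycle.

Section Simplices.
Variable X : digital_image.

Definition is_simplex q (x : {ffun 'I_q.+1 -> X}) : bool :=
  [forall i, forall j, (i != j) ==> adj (x i) (x j)].

Definition simplex q := {x : {ffun 'I_q.+1 -> X} | is_simplex x}.

HB.instance Definition _ q := Choice.on (simplex q).

Definition permute q (x : {ffun 'I_q.+1 -> X}) (s : 'S_q.+1) :
  {ffun 'I_q.+1 -> X} := [ffun i => x (s i)].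

Definition face q (x : {ffun 'I_q.+2 -> X}) (i : 'I_q.+2) :
  {ffun 'I_q.+1 -> X} := [ffun k => x (lift i k)].

Lemma is_simplexP q (x : {ffun 'I_q.+1 -> X}) :
  reflect (forall i j, i != j -> adj (x i) (x j)) (is_simplex x).
Proof.
apply: (iffP forallP) => [xs i j|xs i].
  by move/forallP: (xs i) => /(_ j)/implyP.
by apply/forallP=> j; apply/implyP/xs.
Qed.

Lemma is_simplex_permute q (x : {ffun 'I_q.+1 -> X}) (s : 'S_q.+1) :
  is_simplex (permute x s) = is_simplex x.
Proof.
apply/is_simplexP/is_simplexP=> xs i j ij.
  have := xs ((s^-1)%g i) ((s^-1)%g j).
  by rewrite !ffunE !permKV; apply; rewrite (inj_eq perm_inj).
by rewrite !ffunE; apply: xs; rewrite (inj_eq perm_inj).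
Qed.

Lemma is_simplex_face q (x : {ffun 'I_q.+2 -> X}) i :
  is_simplex x -> is_simplex (face x i).
Proof.
move/is_simplexP=> xs; apply/is_simplexP=> j k jk.
by rewrite !ffunE; apply: xs; rewrite (inj_eq lift_inj).
Qed.

Lemma is_simplex_inj q (x : {ffun 'I_q.+1 -> X}) :
  is_simplex x -> injective x.
Proof.
move/is_simplexP=> xs i j xij; apply/eqP/negPn/negP => /xs.
by rewrite xij adj_irr.
Qed.

Definition simplex_permute q (x : simplex q) (s : 'S_q.+1) : simplex q :=
  exist (@is_simplex q) (permute (val x) s)
    (etrans (is_simplex_permute (val x) s) (valP x)).

Definition generator q (x : simplex q) : {freeg (simplex q) / int} :=
  << 1 *g x >>.

(** The identifications <x_0, ..., x_q> = (-1)^s <x_s(0), ..., x_s(q)>. *)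
Definition chain_relator q (c : {freeg (simplex q) / int}) : Prop :=
  exists (x : simplex q) (s : 'S_q.+1),
    c = generator x - generator (simplex_permute x s) *~ (-1) ^+ s.

Definition chain q : zmodType := {quot gen_subgroup (@chain_relator q)}.

(** The chain <x_0, ..., x_q>, read as 0 if the x_i are not mutually
    adjacent. *)
Definition bracket q (x : {ffun 'I_q.+1 -> X}) : chain q :=
  if insub x is Some y
  then quot_pi (gen_subgroup (@chain_relator q)) (generator y)
  else 0.

Lemma bracket_simplex q (x : simplex q) :
  bracket (val x) = quot_pi (gen_subgroup (@chain_relator q)) (generator x).
Proof. by rewrite /bracket valK. Qed.

Lemma bracket_eq0 q (x : {ffun 'I_q.+1 -> X}) :
  ~~ is_simplex x -> bracket x = 0.
Proof. by move=> xs; rewrite /bracket insubN. Qed.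

Lemma bracket_permute q (x : {ffun 'I_q.+1 -> X}) (s : 'S_q.+1) :
  bracket x = bracket (permute x s) *~ (-1) ^+ s.
Proof.
have [xs|xs] := boolP (is_simplex x); last first.
  by rewrite !bracket_eq0 ?mul0rz // is_simplex_permute.
pose y : simplex q := exist _ x xs.
rewrite -[permute x s]/(val (simplex_permute y s)) -[x in LHS]/(val y).
rewrite !bracket_simplex -raddfMz; apply/eqP; rewrite quot_pi_eq.
apply/asboolP/generated_mem; by exists y, s.
Qed.

Section ChainLift.
Variables (q : nat) (M : zmodType) (h : {ffun 'I_q.+1 -> X} -> M).

(** [zmodule M] is M seen as a module over int. *)
Definition chain_lift_free (c : {freeg (simplex q) / int}) : M :=
  fglift (fun x : simplex q => h (val x) : zmodule M) c.

Fact chain_lift_free_additive : zmod_morphism chain_lift_free.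
Proof.
move=> c d; have := @lift_is_additive int (simplex q) (zmodule M).
by move=> /(_ (fun x => h (val x)) c d).
Qed.

HB.instance Definition _ := GRing.isZmodMorphism.Build
  {freeg (simplex q) / int} M chain_lift_free chain_lift_free_additive.

Lemma chain_lift_free_generator (x : simplex q) :
  chain_lift_free (generator x) = h (val x).
Proof. by rewrite /chain_lift_free /generator liftU scale1r. Qed.

Hypothesis hP : forall x s, h x = h (permute x s) *~ (-1) ^+ s.

Fact chain_lift_subproof c :
  c \in gen_subgroup (@chain_relator q) -> chain_lift_free c = 0.
Proof.
move=> /asboolP; elim=> [_ [x [s ->]]||y z _ hy _ hz].
- rewrite raddfB raddfMz /= !chain_lift_free_generator; apply/eqP; rewrite subr_eq0.
  exact/eqP/hP.
- exact: raddf0.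
- by rewrite raddfB /= hy hz subrr.
Qed.

Definition chain_lift : {additive chain q -> M} :=
  quot_lift chain_lift_subproof.

Lemma chain_liftE (x : {ffun 'I_q.+1 -> X}) :
  is_simplex x -> chain_lift (bracket x) = h x.
Proof.
move=> xs; pose y : simplex q := exist _ x xs.
rewrite -[x]/(val y) bracket_simplex.
by rewrite [LHS]quot_liftE /= chain_lift_free_generator.
Qed.

End ChainLift.

Lemma chain_ext q (M : zmodType) (a b : {additive chain q -> M}) :
  (forall x, is_simplex x -> a (bracket x) = b (bracket x)) -> a =1 b.
Proof.
move=> ab c; have [d ->] := quot_piP c; elim/freeg_ind_dom0: d.
  by rewrite !raddf0.
move=> k x D _ _ IH; rewrite raddfD !(raddfD a, raddfD b) IH; congr (_ + _).
have -> : << k *g x >> = generator x *~ k.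
  by rewrite /generator freeg_mulz intz.
rewrite raddfMz (raddfMz a) (raddfMz b); congr (_ *~ _).
by have := ab _ (valP x); rewrite bracket_simplex.
Qed.

Definition boundary_bracket q (x : {ffun 'I_q.+2 -> X}) : chain q :=
  \sum_(i < q.+2) bracket (face x i) *~ (-1) ^+ i.

Lemma perm_lift q (s : 'S_q.+2) (i : 'I_q.+2) :
  exists s' : 'S_q.+1, s = lift_perm i (s i) s'.
Proof.
have inj : injective (fun k => odflt k (unlift (s i) (s (lift i k)))).
  move=> k l; case: unliftP => [k' ek|/perm_inj/eqP]; last first.
    by rewrite (negPf (neq_lift i k)) || rewrite eq_sym (negPf (neq_lift i k)).
  case: unliftP => [l' el|/perm_inj/eqP]; last first.
    by rewrite eq_sym (negPf (neq_lift i l)).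
  by move=> /= kl; apply/(@lift_inj _ i)/(@perm_inj _ s); rewrite ek el kl.
exists (perm inj); apply/permP=> j; case: (unliftP i j) => [k ->|->].
  rewrite lift_perm_lift permE; case: unliftP => [k' -> //|/perm_inj/eqP].
  by rewrite eq_sym (negPf (neq_lift i k)).
by rewrite lift_perm_id.
Qed.

Lemma bracket_face_permute q (x : {ffun 'I_q.+2 -> X}) (s : 'S_q.+2) i :
  bracket (face (permute x s) i) *~ (-1) ^+ i =
  bracket (face x (s i)) *~ (-1) ^+ (s i) *~ (-1) ^+ s.
Proof.
have [s' es] := perm_lift s i.
rewrite (bracket_permute (face x (s i)) s').
have -> : permute (face x (s i)) s' = face (permute x s) i.
  by apply/ffunP=> k; rewrite !ffunE [in RHS]es lift_perm_lift.
rewrite -!mulrzA; congr (_ *~ _).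
have -> : (-1) ^+ s = (-1) ^+ i * (-1) ^+ (s i) * (-1) ^+ s' :> int.
  by rewrite {1}es odd_lift_perm !signr_addb !signr_odd.
have gen (u v w : int) : v * v = 1 -> w * w = 1 -> u = w * v * (u * v * w).
  move=> v2 w2; rewrite mulrC mulrA -[u * v * w * w]mulrA w2 mulr1.
  by rewrite -mulrA v2 mulr1.
by rewrite mulrA; apply: gen; rewrite -expr2 -exprM mulnC exprM sqrrN !expr1n.
Qed.

Lemma boundary_bracket_permute q (x : {ffun 'I_q.+2 -> X}) (s : 'S_q.+2) :
  boundary_bracket x = boundary_bracket (permute x s) *~ (-1) ^+ s.
Proof.
rewrite /boundary_bracket (reindex_inj (@perm_inj _ s)) mulrz_suml.
apply: eq_bigr => i _; rewrite bracket_face_permute -mulrzA.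
by rewrite -expr2 sqrr_sign mulr1z.
Qed.

Lemma boundary_bracket_repeat q (x : {ffun 'I_q.+2 -> X}) :
  ~ injective x -> boundary_bracket x = 0.
Proof.
move=> /injectiveP/injectivePn[a [b ab xab]].
have xt : permute x (tperm a b) = x.
  by apply/ffunP=> i; rewrite ffunE; case: tpermP => [->|->|].
rewrite /boundary_bracket (bigD1 a) //= (bigD1 b) 1?eq_sym //= big1 ?addr0.
  have := bracket_face_permute x (tperm a b) a.
  by rewrite xt tpermL odd_tperm ab expr1 mulrN1z => ->; rewrite addNr.
move=> i /andP[ia ib]; rewrite bracket_eq0 ?mul0rz //; apply/negP.
have [a' ea|ea] := unliftP i a; last by rewrite ea eqxx in ia.
have [b' eb|eb] := unliftP i b; last by rewrite eb eqxx in ib.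
move/is_simplex_inj => /(_ a' b'); rewrite !ffunE -ea -eb => /(_ xab) ab'.
by rewrite ea eb ab' eqxx in ab.
Qed.

Definition boundary_succ q : {additive chain q.+1 -> chain q} :=
  chain_lift (@boundary_bracket_permute q).

Definition boundary q : {additive chain q -> chain q.-1} :=
  match q with
  | 0 => \0
  | q'.+1 => boundary_succ q'
  end.

Lemma boundary_succE q (x : {ffun 'I_q.+2 -> X}) :
  is_simplex x -> boundary q.+1 (bracket x) = boundary_bracket x.
Proof. exact: chain_liftE. Qed.

Lemma face_face q (x : {ffun 'I_q.+3 -> X})
    (i i' : 'I_q.+3) (j j' : 'I_q.+2) :
  (j < i)%N -> i' = j :> nat -> j' = i.-1 :> nat ->
  face (face x i) j = face (face x i') j'.
Proof.
move=> ji ei ej; apply/ffunP=> k; rewrite !ffunE; congr (x _).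
apply/val_inj; rewrite /= ei ej /bump.
case: (nat_of_ord i) ji => [//|m] /=; rewrite ltnS => jm.
by case: (leqP j k) => jk; case: (leqP m k) => mk; rewrite ?add0n ?add1n; lia.
Qed.

Lemma boundary_boundary q (c : chain q.+2) :
  boundary q.+1 (boundary q.+2 c) = 0.
Proof.
pose F := (boundary q.+1 \o boundary q.+2 : {additive _ -> _}).
pose G := (\0 : {additive chain q.+2 -> chain q}).
suff : F =1 G by move/(_ c).
apply: chain_ext => x xs.
change (boundary q.+1 (boundary q.+2 (bracket x)) = 0).
rewrite (boundary_succE xs) raddf_sum.
pose T i j := bracket (face (face x i) j) *~ ((-1) ^+ j * (-1) ^+ i).
have -> : \sum_(i < q.+3) boundary q.+1 (bracket (face x i) *~ (-1) ^+ i) =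
          \sum_(p : 'I_q.+3 * 'I_q.+2) T p.1 p.2.
  rewrite -(pair_bigA _ T); apply: eq_bigr => i _.
  rewrite raddfMz boundary_succE ?is_simplex_face // mulrz_suml.
  by apply: eq_bigr => j _; rewrite -mulrzA.
rewrite (bigID (fun p : 'I_q.+3 * 'I_q.+2 => p.2 < p.1)%N) /=.
apply/eqP; rewrite addr_eq0 -sumrN; apply/eqP.
pose h (p : 'I_q.+3 * 'I_q.+2) : 'I_q.+3 * 'I_q.+2 := (inord p.2, inord p.1.-1).
pose h' (p : 'I_q.+3 * 'I_q.+2) : 'I_q.+3 * 'I_q.+2 := (inord p.2.+1, inord p.1).
rewrite [RHS](reindex_onto h h') /=; last first.
  move=> [a b] /=; rewrite -leqNgt => ab; have := ltn_ord b => ltb.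
  congr (_, _); apply/val_inj; rewrite /= !inordK //=; lia.
apply: eq_big => [[i j]|[i j] /= ji].
  have lti := ltn_ord i; have ltj := ltn_ord j.
  rewrite /h /h' /= -leqNgt xpair_eqE -!val_eqE /=.
  have [ji|ij] := ltnP j i; first by rewrite !inordK ?eqxx; lia.
  by rewrite !inordK; lia.
have lti := ltn_ord i; have ltj := ltn_ord j.
rewrite /T (face_face x (i' := inord j) (j' := inord i.-1)) // ?inordK; try lia.
rewrite -mulrNz; congr (_ *~ _).
case: (nat_of_ord i) ji => [//|m] _ /=.
by rewrite exprS mulN1r mulrN mulrC.
Qed.

End Simplices.

Arguments chain_lift : simpl never.
Arguments boundary_succ : simpl never.
Arguments boundary : simpl never.

Definition homology (X : digital_image) q : zmodType :=
  ker_mod_im (boundary X q.+1) (boundary X q).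

Section InducedMap.
Variables (X Y : digital_image) (f : X -> Y).

Definition push q (x : {ffun 'I_q.+1 -> X}) : {ffun 'I_q.+1 -> Y} :=
  [ffun i => f (x i)].

Lemma push_permute q (x : {ffun 'I_q.+1 -> X}) s :
  push (permute x s) = permute (push x) s.
Proof. by apply/ffunP=> i; rewrite !ffunE. Qed.

Lemma push_face q (x : {ffun 'I_q.+2 -> X}) i :
  push (face x i) = face (push x) i.
Proof. by apply/ffunP=> k; rewrite !ffunE. Qed.

Fact push_bracket_permute q (x : {ffun 'I_q.+1 -> X}) (s : 'S_q.+1) :
  bracket (push x) = bracket (push (permute x s)) *~ (-1) ^+ s.
Proof. by rewrite push_permute -bracket_permute. Qed.

Definition chain_map q : {additive chain X q -> chain Y q} :=
  chain_lift (@push_bracket_permute q).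

Lemma chain_mapE q (x : {ffun 'I_q.+1 -> X}) :
  is_simplex x -> chain_map q (bracket x) = bracket (push x).
Proof. exact: chain_liftE. Qed.

Hypothesis fc : dcontinuous f.

(** For continuous f, the reading of the right-hand side of [chain_mapE] as 0
    happens exactly when f x_0, ..., f x_q are not all distinct. *)
Lemma is_simplex_push q (x : {ffun 'I_q.+1 -> X}) :
  is_simplex x -> is_simplex (push x) <-> injective (push x).
Proof.
move=> xs; split; first exact: is_simplex_inj.
move=> inj; apply/is_simplexP=> i j ij.
have /fc := is_simplexP _ xs i j ij; rewrite !ffunE => /orP[//|/eqP e].
by case/eqP: ij; apply: inj; rewrite !ffunE.
Qed.

Lemma chain_map_boundary q (c : chain X q) :
  chain_map q.-1 (boundary X q c) = boundary Y q (chain_map q c).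
Proof.
case: q c => [|q] c; first by rewrite raddf0.
pose F := (chain_map q \o boundary X q.+1 : {additive _ -> _}).
pose G := (boundary Y q.+1 \o chain_map q.+1 : {additive _ -> _}).
suff : F =1 G by move/(_ c).
apply: chain_ext => x xs.
change (chain_map q (boundary X q.+1 (bracket x)) =
  boundary Y q.+1 (chain_map q.+1 (bracket x))).
rewrite (boundary_succE xs) (chain_mapE xs).
transitivity (boundary_bracket (push x)).
  rewrite /boundary_bracket raddf_sum; apply: eq_bigr => i _.
  by rewrite raddfMz chain_mapE ?is_simplex_face // push_face.
have [ps|ps] := boolP (is_simplex (push x)); first by rewrite boundary_succE.
rewrite (bracket_eq0 ps) raddf0 boundary_bracket_repeat //.
by move/(is_simplex_push xs).2; apply/negP.
Qed.

Definition induced q : {additive homology X q -> homology Y q} :=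
  ker_mod_im_map (@chain_map_boundary q.+1) (@chain_map_boundary q).

End InducedMap.

Arguments chain_map : simpl never.
Arguments induced : simpl never.

(* Main.v *)
(** A continuous selfmap f of C_n moves along an edge by a signed step -1, 0 or
    1, and these steps around the cycle add up to n times an integer, the degree
    of f.  Since n > 4 the squares of a homotopy close up already in Z, so the
    degree is a homotopy invariant; since n > 3 there are no triangles, so the
    1-cycles are the multiples of the fundamental cycle and f multiplies them by
    its degree.  Lifting f to Z, the degree is 1, -1 or 0.  In the first two
    cases f is id or the flip up to a rotation; in the last f factors through Z
    and is contracted there. *)
Require Import Defs.
From mathcomp Require Import all_boot all_order all_algebra.
From mathcomp Require Import perm freeg boolp zify.

Set Implicit Arguments.
Unset Strict Implicit.
Unset Printing Implicit Defensive.

Import Order.TTheory GRing.Theory Num.Theory.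
Local Open Scope ring_scope.

Lemma Zp_natr_val n (x : 'Z_n) : (1 < n)%N -> (x : nat)%:R = x.
Proof. by case: n x => [|[|m]] // x _; rewrite natr_Zp. Qed.

(** * Signed steps between residues modulo n *)

Section Steps.
Variable n : nat.
Hypothesis n_gt2 : (2 < n)%N.
Let n_gt1 : (1 < n)%N := ltnW n_gt2.

(** Lifts congruences mod n to equalities in Z; the bounds n > 3 and n > 4 of the later arguments
    act through it. *)
Lemma Zp_intr_inj (a b : int) :
  `|a - b| < n%:Z -> a%:~R = b%:~R :> 'Z_n -> a = b.
Proof.
move=> ab_lt /eqP; rewrite -subr_eq0 -intrB.
have : a - b = 0 -> a = b by move/eqP; rewrite subr_eq0 => /eqP.
have natr0 (k : nat) : (k < n)%N -> k%:R == 0 :> 'Z_n -> k = 0%N.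
  by move=> kn /eqP/(congr1 val); rewrite /= val_Zp_nat // modn_small.
case: (a - b) ab_lt => k k_lt; move: k_lt => + h0.
  by move=> k_lt k0; apply: h0; rewrite (natr0 k) //; lia.
rewrite NegzE mulrNz oppr_eq0 => k_lt k0.
by have := natr0 k.+1; rewrite k0 => /(_ _ isT); lia.
Qed.

Lemma Zp_sum (g : 'Z_n -> int) : \sum_i g i = \sum_(0 <= k < n) g k%:R.
Proof.
case: n n_gt1 g => [|[|m]] // _ g; rewrite big_mkord.
by apply: eq_bigr => i _; rewrite natr_Zp.
Qed.

Lemma Zp_sum1 (g : 'Z_n -> int) d :
  (forall i, g i = d) -> \sum_i g i = n%:Z * d.
Proof.
move=> gd; rewrite Zp_sum (eq_bigr (fun=> d)) // sumr_const_nat subn0.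
by rewrite -mulr_natl natz.
Qed.

(** Its junk value is 0 when x and y are not adjacent. *)
Definition step (x y : 'Z_n) : int := (y == x + 1)%:Z - (x == y + 1)%:Z.

Lemma stepC x y : step x y = - step y x.
Proof. by rewrite /step opprB. Qed.

Lemma norm_step x y : `|step x y| <= 1.
Proof. by rewrite /step; case: eqP; case: eqP. Qed.

(** Since n > 2, the residues of -1, 0 and 1 are distinct, so the endpoints determine d. *)
Lemma step_addr (x : 'Z_n) (d : int) : `|d| <= 1 -> step x (x + d%:~R) = d.
Proof.
have inj1 (e : int) : `|e| <= 2 -> (e%:~R == 0 :> 'Z_n) = (e == 0).
  move=> e2; apply/eqP/eqP => [e0|->//].
  by apply: Zp_intr_inj; rewrite ?subr0 //; lia.
move=> d1; rewrite /step (inj_eq (addrI x)) -addrA -subr_eq0 -(subr_eq0 x).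
have -> : d%:~R - 1 = (d - 1)%:~R :> 'Z_n by rewrite intrB.
have -> : x - (x + (d%:~R + 1)) = (- d - 1)%:~R.
  by rewrite opprD addNKr intrB opprD mulrNz.
by rewrite !inj1; lia.
Qed.

Lemma adjeq_cycle (x y : digital_cycle n) :
  adjeq x y <-> exists2 d : int, `|d| <= 1 & y = (x : 'Z_n) + d%:~R.
Proof.
rewrite /adjeq /= /cycle_adj; split=> [/orP[/orP[]|]/eqP ->|[d d1 ->]].
- by exists 1.
- by exists (-1); rewrite // mulrN1z addrK.
- by exists 0; rewrite // addr0.
have : d = 1 \/ d = -1 \/ d = 0 by lia.
case=> [->|[->|->]]; first by rewrite eqxx.
  by rewrite mulrN1z subrK eqxx orbT.
by rewrite addr0 eqxx !orbT.
Qed.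

Lemma step_adjeq (x y : digital_cycle n) :
  adjeq x y -> y = (x : 'Z_n) + (step x y)%:~R.
Proof. by move=> /adjeq_cycle[d d1 ->]; rewrite step_addr. Qed.

(** n times the degree of f. *)
Definition degree_sum (f : 'Z_n -> 'Z_n) : int := \sum_i step (f i) (f (i + 1)).

Lemma continuous_succ (f : digital_cycle n -> digital_cycle n) :
  dcontinuous f <-> forall i : 'Z_n, adjeq (f i) (f (i + 1)).
Proof.
split=> [fc i|fc i j]; first by apply: fc; rewrite /= /cycle_adj eqxx.
rewrite /= /cycle_adj => /orP[]/eqP-> //.
by rewrite /adjeq adj_sym eq_sym; apply: fc.
Qed.

End Steps.

(** * Homotopy invariance of the degree *)

Section DegreeHomotopy.
Variable n : nat.
Hypothesis n_gt4 : (4 < n)%N.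
Let n_gt2 : (2 < n)%N := ltnW (ltnW n_gt4).
Implicit Types f g : digital_cycle n -> digital_cycle n.

(* Both ways round the square f i, f (i+1), g i, g (i+1) have the same signed
   length: the difference is 0 mod n and at most 4 < n in absolute value. *)
Lemma degree_sum_adjeq f g : dcontinuous f -> dcontinuous g ->
  (forall x, adjeq (f x) (g x)) -> degree_sum f = degree_sum g.
Proof.
move=> /continuous_succ fc /continuous_succ gc fg.
pose u i := step (f i) (g i).
have square i :
    step (f i) (f (i + 1)) = u i + step (g i) (g (i + 1)) - u (i + 1).
  have e1 := step_adjeq n_gt2 (fc i); have e2 := step_adjeq n_gt2 (gc i).
  have e3 := step_adjeq n_gt2 (fg i); have e4 := step_adjeq n_gt2 (fg (i + 1)).
  apply: (Zp_intr_inj n_gt2).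
    move: (norm_step (f i) (f (i + 1))) (norm_step (g i) (g (i + 1))).
    move: (norm_step (f i) (g i)) (norm_step (f (i + 1)) (g (i + 1))).
    by rewrite -!/(u _); lia.
  apply: (addrI (f i : 'Z_n)); rewrite -e1 intrB intrD !addrA -e3 -e2.
  by rewrite e4 addrK.
(* Rotation by 1 permutes the cycle, so the terms [u i] and [u (i + 1)] cancel in the total. *)
have shift : \sum_i u i = \sum_(i : 'Z_n) u (i + 1).
  by rewrite (reindex_inj (addIr (1 : 'Z_n))).
rewrite /degree_sum (eq_bigr _ (fun i _ => square i)) big_split big_split /=.
by rewrite sumrN -shift addrC addKr.
Qed.

(** Consecutive stages of a homotopy are pointwise adjacent or equal, so [degree_sum_adjeq] applies
    at each unit of time. *)
Lemma degree_sum_homotopic f g : homotopic f g -> degree_sum f = degree_sum g.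
Proof.
move=> [k [_ [H [H0 Hk Ht Hx]]]].
have <- : (fun x => H x ord0) = f by apply/funext.
have <- : (fun x => H x ord_max) = g by apply/funext.
have deg_eq j : (j <= k)%N ->
    degree_sum (fun x => H x ord0) = degree_sum (fun x => H x (inord j)).
  elim: j => [|j IH] jk.
    have -> // : ord0 = inord 0 :> 'I_k.+1.
    by apply/val_inj; rewrite /= inordK.
  rewrite (IH (ltnW jk)); apply: degree_sum_adjeq => // x.
  by apply: Ht; rewrite /= /interval_adj !inordK; lia.
rewrite (deg_eq k) //; have -> // : ord_max = inord k :> 'I_k.+1.
by apply/val_inj; rewrite /= inordK.
Qed.

Lemma degree_sum_id : degree_sum (id : 'Z_n -> 'Z_n) = n%:Z.
Proof.
rewrite -[RHS]mulr1; apply: Zp_sum1 => // i.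
by rewrite -[1 in X in step _ X]/(1%:~R) step_addr.
Qed.

Lemma degree_sum_flip : degree_sum (@cycle_flip n) = - n%:Z.
Proof.
rewrite -[RHS]mulrN1; apply: Zp_sum1 => // i.
by rewrite /cycle_flip opprD -[- 1 in X in step _ X]/((-1)%:~R) step_addr.
Qed.

Lemma degree_sum_const : degree_sum (@cycle_const n) = 0.
Proof. by rewrite -[RHS](mulr0 n%:Z); apply: Zp_sum1. Qed.

End DegreeHomotopy.

(** * Selfmaps of the cycle up to homotopy *)

Section Classification.
Variable n : nat.
Hypothesis n_gt2 : (2 < n)%N.
Let n_gt1 : (1 < n)%N := ltnW n_gt2.
Implicit Types f g : digital_cycle n -> digital_cycle n.

Lemma homotopic_translate g (c : 'Z_n) :
  dcontinuous g ->
  homotopic (Y := digital_cycle n) (fun x => (g x : 'Z_n) + c) g.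
Proof.
move=> /continuous_succ gc.
(* The offset c - t turns back by 1 per unit of time and is 0 mod n at t = n + c; the summand n
   keeps the duration positive when c = 0. *)
exists (n + c)%N; split; first by lia.
exists (fun x (t : 'I_(n + c).+1) => (g x : 'Z_n) + (c - (t : nat)%:R)).
split=> [x|x|x s t|t].
- by rewrite subr0.
- by rewrite /= natrD Zp_natr_val // pchar_Zp // add0r subrr addr0.
- rewrite /= /interval_adj => /eqP st; apply/(adjeq_cycle n_gt2).
  exists ((s : nat)%:Z - (t : nat)%:Z); first by rewrite st.
  by rewrite intrB -!addrA !pmulrn; congr (_ + (_ + _)); rewrite addKr.
- apply/continuous_succ => i; apply/(adjeq_cycle n_gt2).
  have /(adjeq_cycle n_gt2)[d d1 ->] := gc i; exists d => //.
  by rewrite addrAC.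
Qed.

(** Contracts the integer line: z moves t units towards 0 and, by truncated subtraction, stops
    there. It changes by at most 1 when t or z does. *)
Definition shrink (t : nat) (z : int) : int :=
  match z with
  | Posz a => (a - t)%N
  | Negz a => - (a.+1 - t)%N%:Z
  end.

(** The lift is shrunk to 0 in Z and projected back. The bound on F includes the wrap from n - 1 to
    0, so f does not wind around. *)
Lemma homotopic_const_lift f (F : 'Z_n -> int) :
  (forall x, f x = (F x)%:~R) -> (forall i, `|F (i + 1) - F i| <= 1) ->
  homotopic f (@cycle_const n).
Proof.
move=> fF F1; pose b := (\max_i `|F i|%N).+1.
exists b; split=> //; exists (fun x (t : 'I_b.+1) => (shrink t (F x))%:~R).
split=> [x|x|x s t|t].
- by rewrite fF; case: (F x) => a; rewrite /= subn0 // NegzE.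
- have : (`|F x| <= b)%N by rewrite leqW // (leq_bigmax x).
  rewrite /cycle_const /=; case: (F x) => a /= ab.
    by have -> : (a - b = 0)%N by lia.
  by have -> : (a.+1 - b = 0)%N by lia.
- rewrite /= /interval_adj => /eqP st; apply/(adjeq_cycle n_gt2).
  exists (shrink t (F x) - shrink s (F x)); last first.
    by rewrite intrB [RHS]addrC subrK.
  by case: (F x) => a /=; lia.
- apply/continuous_succ => i; apply/(adjeq_cycle n_gt2).
  exists (shrink t (F (i + 1)) - shrink t (F i)).
    by move: (F1 i); case: (F i) => a; case: (F (i + 1)) => c /=; lia.
  by rewrite intrB [RHS]addrC subrK.
Qed.

Lemma homotopic_classification f : dcontinuous f ->
  [\/ homotopic f id, homotopic f (@cycle_flip n)
    | homotopic f (@cycle_const n)].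
Proof.
move=> fc; have /continuous_succ fs := fc.
pose d (k : nat) := step (f (k%:R : 'Z_n)) (f (k%:R + 1)).
(* [F k] is the displacement of a lift of f to Z after k steps from 0; [F n] is n times the
   degree. *)
pose F k := \sum_(0 <= j < k) d j.
have F1 k : F k.+1 = F k + d k by rewrite /F big_nat_recr.
have d1 k : `|d k| <= 1 by apply: norm_step.
have fF k : f (k%:R : 'Z_n) = (f 0 : 'Z_n) + (F k)%:~R.
  elim: k => [|k IH]; first by rewrite /F big_nil addr0.
  by rewrite F1 intrD addrA -IH -natr1; apply: step_adjeq.
have xE (x : 'Z_n) := Zp_natr_val x n_gt1.
have ltx (x : 'Z_n) : (x < n)%N.
  by rewrite -[X in (_ < X)%N](Zp_cast n_gt1) ltn_ord.
(* A lift of total displacement n, in absolute value, cannot afford a single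
   step in the other direction. *)
have extremal (e : int) : `|e| = 1 -> F n = e * n%:Z ->
    forall x, f x = (x : 'Z_n) * e%:~R + (f 0 : 'Z_n).
  move=> e1 Fn.
  have up k j : `|F (k + j)%N - F k| <= j%:Z.
    elim: j => [|j IH]; first by rewrite addn0 subrr.
    by rewrite addnS F1; move: IH (d1 (k + j)%N); lia.
  have Fe k : (k <= n)%N -> F k = e * k%:Z.
    move=> kn; have := up k (n - k)%N; have := up 0%N k.
    rewrite subnKC // Fn add0n {2}/F big_nil.
    by have [->|->] : e = 1 \/ e = -1 by [lia]; lia.
  move=> x; rewrite -{1}(xE x) fF Fe ?(ltnW (ltx x)) // addrC.
  by rewrite intrM mulrC -pmulrn xE.
(* After n steps f is back at [f 0], so [F n] is 0 mod n, and its remainder on division by n must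
   vanish. *)
have [m Fm] : exists m : int, F n = m * n%:Z.
  have : (F n)%:~R = 0 :> 'Z_n.
    by apply: (addrI (f 0 : 'Z_n)); rewrite -fF pchar_Zp // addr0.
  move=> Fn0; exists (F n %/ n)%Z.
  rewrite {1}(divz_eq (F n) n) -[RHS]addr0; congr (_ + _).
  apply: (Zp_intr_inj n_gt2).
    by rewrite subr0 ger0_norm ?modz_ge0 ?ltz_pmod //; lia.
  move: Fn0; rewrite {1}(divz_eq (F n) n) intrD intrM -[n%:~R]/(n%:R)
     pchar_Zp // mulr0 add0r.
  by [].
have Fle : `|F n| <= n%:Z.
  have up j : `|F j| <= j%:Z.
    elim: j => [|j IH]; first by rewrite /F big_nil.
    by rewrite F1; move: IH (d1 j); lia.
  exact: up.
have : m = 1 \/ m = -1 \/ m = 0.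
  by have : `|m| <= 1 by [move: Fle; rewrite Fm; nia]; lia.
case=> [|[|]] me; move: Fm; rewrite me.
- move=> /extremal fx; constructor 1.
  have -> : f = (fun x => (id x : 'Z_n) + (f 0 : 'Z_n)).
    by apply/funext=> x; rewrite fx // mulr1.
  apply: homotopic_translate; apply/continuous_succ => i.
  by rewrite /adjeq /= /cycle_adj eqxx.
- move=> /extremal fx; constructor 2.
  have -> : f = (fun x => (cycle_flip x : 'Z_n) + (f 0 : 'Z_n)).
    by apply/funext=> x; rewrite fx // mulrN1.
  by apply: homotopic_translate; apply: cycle_flip_continuous.
- rewrite mul0r => Fn; constructor 3.
  pose G (x : 'Z_n) := (f 0 : nat)%:Z + F x.
  apply: (@homotopic_const_lift f G) => [x|i].
    by rewrite /G intrD -[(f 0 : nat)%:~R]/((f 0 : nat)%:R) xE -fF xE.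
  (* In 'Z_n the successor of n - 1 is 0; there the claim reads [F 0 = F n], which is where degree 0
     is used. *)
  have FS : F (i + 1)%R = F i.+1.
    have [iS|iS] := ltnP i.+1 n.
      congr F; rewrite -[X in X + 1]xE natr1 val_Zp_nat // modn_small //.
    have iE : i.+1 = n by apply/eqP; rewrite eqn_leq iS ltx.
    rewrite iE Fn -[X in X + 1]xE natr1 iE pchar_Zp // /= /F big_nil //.
  by rewrite /G FS F1; move: (d1 i); lia.
Qed.

End Classification.

(** * Induction on chains; vertices and edges as generators *)

Section LowDimensionalChains.
Variable X : digital_image.

(** Serves for existential predicates, where [chain_ext] does not apply: the brackets generate the
    group, and closure under differences yields all integer multiples and sums. *)
Lemma chain_ind q (P : chain X q -> Prop) :
  P 0 -> (forall c d, P c -> P d -> P (c - d)) ->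
  (forall x, is_simplex x -> P (bracket x)) -> forall c, P c.
Proof.
move=> P0 PB Pb c; have [d ->] := quot_piP c.
have PN e : P e -> P (- e) by rewrite -[- e]add0r; apply: PB.
have PD e e' : P e -> P e' -> P (e + e').
  by move=> Pe Pe'; rewrite -[e']opprK; apply/PB/PN.
elim/freeg_ind_dom0: d => [|k x D _ _ IH]; first by rewrite raddf0.
rewrite raddfD; apply: (PD) => //.
have -> : << k *g x >> = generator x *~ k.
  by rewrite /generator freeg_mulz intz.
rewrite raddfMz /= -bracket_simplex.
have Pn m : P (bracket (val x) *+ m).
  elim: m => [|m IHm]; first by rewrite mulr0n.
  by rewrite mulrS; apply: PD IHm; apply/Pb/valP.
by case: k => m; [apply: Pn | apply/PN/Pn].
Qed.

Definition vertex (x : X) : {ffun 'I_1 -> X} := [ffun=> x].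

Definition edge (x y : X) : {ffun 'I_2 -> X} :=
  [ffun k => if k == ord0 then x else y].

Lemma vertex_eta (x : {ffun 'I_1 -> X}) : x = vertex (x ord0).
Proof. by apply/ffunP=> i; rewrite ffunE (ord1 i). Qed.

Lemma edge_eta (x : {ffun 'I_2 -> X}) : x = edge (x ord0) (x ord_max).
Proof.
apply/ffunP=> i; rewrite ffunE; case: eqP => [->//|i0]; congr (x _).
by apply/val_inj; case: i i0 => [[|[|]]] //= ? i0; case: i0; apply/val_inj.
Qed.

Lemma is_simplex_vertex x : is_simplex (vertex x).
Proof. by apply/is_simplexP=> i j; rewrite (ord1 i) (ord1 j) eqxx. Qed.

Lemma is_simplex_edge x y : is_simplex (edge x y) = adj x y.
Proof.
apply/is_simplexP/idP => [/(_ ord0 ord_max isT)|xy i j ij].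
  by rewrite !ffunE.
rewrite !ffunE; case: ifPn => [/eqP i0|i0]; case: ifPn => [/eqP j0|j0] //.
- by rewrite i0 j0 eqxx in ij.
- by rewrite adj_sym.
- case/eqP: ij; case: i i0 => [[|[|]]] // ? _.
  by case: j j0 => [[|[|]]] // ? _; apply/val_inj.
Qed.

Lemma boundary_edge x y : adj x y ->
  boundary X 1 (bracket (edge x y)) = bracket (vertex y) - bracket (vertex x).
Proof.
move=> xy; rewrite boundary_succE ?is_simplex_edge // /boundary_bracket.
rewrite !big_ord_recl big_ord0 addr0 /= mulr1z mulrN1z.
by congr (bracket _ - bracket _); apply/ffunP=> k; rewrite !ffunE (ord1 k).
Qed.

Lemma perm1_eq1 (s : 'S_1) : s = 1%g.
Proof. by apply/permP=> i; rewrite [LHS]ord1 [RHS]ord1. Qed.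

(** Gives the compatibility required by [chain_lift] in degree 1: S_2 has only the identity and the
    transposition. *)
Lemma alternating_edge (M : zmodType) (h : X -> X -> M) :
  (forall x y, h x y = - h y x) ->
  forall (x : {ffun 'I_2 -> X}) (s : 'S_2),
    h (x ord0) (x ord_max) =
    h (permute x s ord0) (permute x s ord_max) *~ (-1) ^+ s.
Proof.
move=> hN x s; rewrite !ffunE.
have ord2 (i : 'I_2) : i = ord0 \/ i = ord_max.
  by case: i => [[|[|]]] // ?; [left|right]; apply/val_inj.
have sE : s ord0 != s ord_max by rewrite (inj_eq perm_inj).
case: (ord2 (s ord0)) sE => e0; case: (ord2 (s ord_max)) => e1;
  rewrite e0 e1 // => _.
  have -> : s = 1%g by apply/permP=> i; rewrite perm1; case: (ord2 i) => ->.
  by rewrite odd_perm1 mulr1z.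
have -> : s = tperm ord0 ord_max.
  by apply/permP=> i; case: (ord2 i) => ->; rewrite ?tpermL ?tpermR.
by rewrite odd_tperm /= expr1 mulrN1z.
Qed.

Lemma bracket_edgeC x y : bracket (edge x y) = - bracket (edge y x).
Proof.
rewrite (bracket_permute _ (tperm ord0 ord_max)) odd_tperm expr1 mulrN1z.
by congr (- bracket _); rewrite [LHS]edge_eta !ffunE tpermL tpermR.
Qed.

End LowDimensionalChains.

(** * Homology of the cycle and the induced maps *)

Section CycleHomology.
Variable n : nat.
Hypothesis n_gt2 : (2 < n)%N.
Let n_gt1 : (1 < n)%N := ltnW n_gt2.
Local Notation C := (digital_cycle n).

Fact coef0_permute (j : C) (x : {ffun 'I_1 -> C}) (s : 'S_1) :
  (x ord0 == j)%:Z = (permute x s ord0 == j)%:Z *~ (-1) ^+ s.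
Proof. by rewrite (perm1_eq1 s) ffunE perm1 odd_perm1 mulr1z. Qed.

Definition coef0 (j : C) : {additive chain C 0 -> int} :=
  chain_lift (coef0_permute j).

(** The 1-cochain measuring signed length; its value n on the fundamental cycle makes it detect
    winding. *)
Definition step_sum : {additive chain C 1 -> int} :=
  chain_lift (alternating_edge (X := C) (h := @step n) (@stepC n)).

Lemma coef0_vertex j x : coef0 j (bracket (vertex x)) = (x == j)%:Z.
Proof. by rewrite chain_liftE ?is_simplex_vertex // ffunE. Qed.

(** Also covers edges collapsed by f: for x = y the bracket and the step are both 0. *)
Lemma step_sum_edge (x y : C) : adjeq x y ->
  step_sum (bracket (edge x y)) = step x y.
Proof.
have [xy _|xy /orP[/(negP xy)//|/eqP->]] := boolP (adj x y).
  by rewrite chain_liftE ?is_simplex_edge // !ffunE.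
by rewrite bracket_eq0 ?is_simplex_edge ?adj_irr // raddf0 /step subrr.
Qed.

Definition fundamental_cycle : chain C 1 :=
  \sum_(i : 'Z_n) bracket (edge (i : C) (i + 1)).

Lemma adj_succ (i : 'Z_n) : adj (i : C) (i + 1).
Proof. by rewrite /= /cycle_adj eqxx. Qed.

Lemma chain1_cycle (c : chain C 1) : exists a : 'Z_n -> int,
  c = \sum_i bracket (edge (i : C) (i + 1)) *~ a i.
Proof.
elim/chain_ind: c => [|c d [a ->] [b ->]|x].
- by exists (fun=> 0); rewrite big1.
- exists (fun i => a i - b i); rewrite -sumrB.
  by apply: eq_bigr => i _; rewrite mulrzBr.
rewrite (edge_eta x) is_simplex_edge.
have single (i : 'Z_n) (e : int) : bracket (edge (i : C) (i + 1)) *~ e =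
    \sum_j bracket (edge (j : C) (j + 1)) *~ (if j == i then e else 0).
  by rewrite (bigD1 i) //= eqxx big1 ?addr0 // => j /negPf->.
rewrite {1}/adj /= /cycle_adj => /orP[]/eqP->.
  by exists (fun j => if j == x ord0 then 1 else 0); rewrite -single mulr1z.
exists (fun j => if j == x ord_max then -1 else 0).
by rewrite -single mulrN1z bracket_edgeC.
Qed.

(** The vertex j + 1 has coefficient [a j - a (j + 1)] in the boundary, so the coefficients of a
    cycle are constant. *)
Lemma cycle1_fundamental (z : chain C 1) :
  boundary C 1 z = 0 -> exists m : int, z = fundamental_cycle *~ m.
Proof.
have [a ->] := chain1_cycle z; rewrite raddf_sum => dz.
have a_succ (j : 'Z_n) : a j = a (j + 1).
  have := congr1 (coef0 (j + 1)) dz; rewrite raddf0 raddf_sum.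
  pose da i := (i == j)%:Z * a i - (i == j + 1)%:Z * a i.
  rewrite (eq_bigr da); last first.
    move=> i _. rewrite !raddfMz boundary_edge ?adj_succ //.
    rewrite raddfB !coef0_vertex (inj_eq (addIr (1 : 'Z_n))).
    by rewrite -mulrzr intz mulrBl.
  rewrite sumrB (bigD1 j) //= eqxx mul1r big1 ?addr0; last first.
    by move=> i /negPf->; rewrite mul0r.
  rewrite (bigD1 (j + 1)) //= eqxx mul1r big1 ?addr0; last first.
    by move=> i /negPf->; rewrite mul0r.
  by move/eqP; rewrite subr_eq0 => /eqP.
have a_const (k : nat) : a k%:R = a 0.
  by elim: k => [|k <-] //; rewrite -natr1 -a_succ.
exists (a 0); rewrite /fundamental_cycle mulrz_suml; apply: eq_bigr => i _.
by rewrite -[in LHS](Zp_natr_val i n_gt1) a_const Zp_natr_val.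
Qed.

Lemma boundary_fundamental : boundary C 1 fundamental_cycle = 0.
Proof.
rewrite raddf_sum (eq_bigr _ (fun i _ => boundary_edge (adj_succ i))) sumrB.
apply/eqP; rewrite subr_eq0; apply/eqP.
by rewrite [RHS](reindex_inj (addIr (1 : 'Z_n))).
Qed.

Lemma vertex_connected (x y : C) : exists u : chain C 1,
  boundary C 1 u = bracket (vertex y) - bracket (vertex x).
Proof.
(* Each vertex z is joined to 0 by the path 0, 1, ..., z; two such paths are then subtracted. *)
suff to0 (z : C) : exists u : chain C 1,
    boundary C 1 u = bracket (vertex z) - bracket (vertex (X := C) (0 : 'Z_n)).
  have [u eu] := to0 x; have [v ev] := to0 y.
  by exists (v - u); rewrite raddfB eu ev opprB addrA subrK.
rewrite -[z](Zp_natr_val (z : 'Z_n) n_gt1).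
elim: (nat_of_ord z) => [|k [u eu]]; first by exists 0; rewrite raddf0 subrr.
exists (u + bracket (edge (X := C) (k%:R : 'Z_n) ((k%:R : 'Z_n) + 1))).
by rewrite raddfD eu boundary_edge ?adj_succ // addrC natr1 addrA subrK.
Qed.

Section Induced.
Variable f : C -> C.
Hypothesis fc : dcontinuous f.

Lemma chain_map_edge (x y : C) : adj x y ->
  chain_map f 1 (bracket (edge x y)) = bracket (edge (f x) (f y)).
Proof.
move=> xy; rewrite chain_mapE ?is_simplex_edge //; congr bracket.
by rewrite [LHS]edge_eta !ffunE.
Qed.

Lemma chain_map1_degree : exists2 m : int, degree_sum f = m * n%:Z &
  forall z, boundary C 1 z = 0 -> chain_map f 1 z = z *~ m.
Proof.
have [m fm] : exists m : int,
    chain_map f 1 fundamental_cycle = fundamental_cycle *~ m.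
  apply: cycle1_fundamental; rewrite -(chain_map_boundary fc).
  by rewrite boundary_fundamental raddf0.
exists m => [|z /cycle1_fundamental[a ->]]; last first.
  by rewrite raddfMz fm -!mulrzA mulrC.
(* Measuring both sides by [step_sum] gives [degree_sum f] on the left and m times n on the
   right. *)
have := congr1 step_sum fm; rewrite raddfMz /fundamental_cycle !raddf_sum.
rewrite (eq_bigr (fun i => step (f i) (f (i + 1)))) => [|i _]; last first.
  by rewrite chain_map_edge ?adj_succ // step_sum_edge // fc ?adj_succ.
move=> deg; rewrite /degree_sum deg (Zp_sum1 n_gt2 (d := 1)) => [|i].
  by rewrite mulr1 -mulrzr intz mulrC.
rewrite step_sum_edge ?/adjeq ?adj_succ //.
by rewrite -[1 in X in step _ X]/(1%:~R) step_addr.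
Qed.

Lemma induced1_degree : exists2 m : int, degree_sum f = m * n%:Z &
  forall h, induced fc 1 h = h *~ m.
Proof.
have [m deg fm] := chain_map1_degree; exists m => // h.
have [z ->] := quot_piP h; rewrite ker_mod_im_mapE -raddfMz; congr quot_pi.
apply: val_inj; rewrite raddfMz; apply: fm; exact/eqP/(valP z).
Qed.

(** A path from each vertex to its image under f makes the two homologous. *)
Lemma induced0_id h : induced fc 0 h = h.
Proof.
have chain0 (c : chain C 0) : exists u, boundary C 1 u = chain_map f 0 c - c.
  elim/chain_ind: c => [|c d [u eu] [v ev]|x xs].
  - by exists 0; rewrite !raddf0 addr0.
  - exists (u - v); rewrite (raddfB (boundary C 1)) eu ev.
    rewrite (raddfB (chain_map f 0)) !opprB addrACA [RHS]addrACA.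
    by rewrite (addrC (- c)).
  have [u eu] := vertex_connected (x ord0) (f (x ord0)); exists u.
  rewrite eu chain_mapE // -vertex_eta; congr (bracket _ - _).
  by rewrite [RHS]vertex_eta ffunE.
have [z ->] := quot_piP h; rewrite ker_mod_im_mapE; apply/eqP.
rewrite quot_pi_eq; apply/asboolP; have [u eu] := chain0 (val z).
by exists u; rewrite eu.
Qed.

End Induced.

Hypothesis n_gt3 : (3 < n)%N.

(* The three steps around a triangle would add up to 0 mod n > 3, hence to 0,
   which is impossible by parity. *)
Lemma cycle_no_triangle (x y z : C) : adj x y -> adj y z -> ~~ adj z x.
Proof.
have adjE (u v : C) : adj u v -> exists2 e : int,
    `|e| = 1 & (v : 'Z_n) = (u : 'Z_n) + e%:~R.
  rewrite /= /cycle_adj => /orP[]/eqP->; first by exists 1.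
  by exists (-1); rewrite // mulrN1z addrK.
move=> /adjE[d d1 ->] /adjE[e e1 ->]; apply/negP=> /adjE[g g1].
rewrite -!addrA -[LHS]addr0 -!intrD => /addrI sum0.
by have : 0 = d + (e + g) by [apply: (Zp_intr_inj n_gt2) => //; lia]; lia.
Qed.

(** The first three points of a generating simplex would form a triangle. *)
Lemma chain_eq0 q (c : chain C q) : (1 < q)%N -> c = 0.
Proof.
move=> q_gt1; elim/chain_ind: c => // [c d -> ->|x /is_simplexP xs].
  by rewrite subrr.
pose v (k : nat) : C := x (inord k).
have vadj j k : (j <= 2)%N -> (k <= 2)%N -> j != k -> adj (v j) (v k).
  by move=> j2 k2 jk; apply: xs; rewrite -val_eqE /= !inordK //; lia.
by have := cycle_no_triangle (vadj 0 1 isT isT isT) (vadj 1 2 isT isT isT);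
  rewrite vadj.
Qed.

Lemma induced_eq0 (f : C -> C) (fc : dcontinuous f) q h :
  (1 < q)%N -> induced fc q h = 0.
Proof.
move=> q_gt1; have [z ->] := quot_piP h.
have -> : z = 0 by apply: val_inj; apply: chain_eq0.
by rewrite !raddf0.
Qed.

End CycleHomology.

Theorem theorem4p7 (n : nat) (hn : (4 < n)%N)
    (f : digital_cycle n -> digital_cycle n) (hf : dcontinuous f) :
  [/\ forall q : nat, (1 < q)%N -> forall h, induced hf q h = 0,
      forall h, induced hf 0 h = h
    & [/\ homotopic f id -> forall h, induced hf 1 h = h,
          homotopic f (@cycle_flip n) -> forall h, induced hf 1 h = - h,
          homotopic f (@cycle_const n) -> forall h, induced hf 1 h = 0
        & [\/ homotopic f id, homotopic f (@cycle_flip n)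
            | homotopic f (@cycle_const n)] ] ].
Proof.
have n_gt3 : (3 < n)%N := ltnW hn; have n_gt2 : (2 < n)%N := ltnW n_gt3.
have [m deg fm] := induced1_degree n_gt2 hf.
(* Cancelling n identifies the multiplier m with the degree, which homotopy invariance then reads
   off the three model maps. *)
have mE (d : int) : degree_sum f = d * n%:Z -> m = d.
  by rewrite deg => /mulIf; apply; lia.
split=> [q q_gt1 h|h|]; first exact: induced_eq0.
  exact: induced0_id.
split; only 1-3: move/(degree_sum_homotopic hn).
- rewrite degree_sum_id // -[RHS]mul1r => /mE m1 h.
  by rewrite fm m1 mulr1z.
- rewrite degree_sum_flip // -mulN1r => /mE m1 h.
  by rewrite fm m1 mulrN1z.
- rewrite degree_sum_const // -[RHS](mul0r n%:Z) => /mE m0 h.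
  by rewrite fm m0 mulr0z.
- exact: homotopic_classification.
Qed.
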